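(* There is a constant $C$ such that for all natural numbers $n,\alpha$ and all $x,y\in\{0,1\}^n$, $$TCC_I^{\alpha+C}(y)\ \le\ TCC_I^{\alpha}(x,y).$$
   Context: Kolmogorov complexity $C(\cdot\mid\cdot)$ is plain conditional Kolmogorov complexity with respect to a fixed universal Turing machine. A protocol for strings of length $n$ is a deterministic two-party communication protocol: Alice holds $x\in\{0,1\}^n$, Bob holds $y\in\{0,1\}^n$, they exchange bits, and Alice outputs a value. Its complexity is $C(P\mid n)$. A protocol is total if it terminates on all inputs; it computes $f$ if on every input $(x,y)\in\{0,1\}^n\times\{0,1\}^n$ Alice outputs $f(x,y)$. $CC^P(x,y)$ is the number of bits exchanged on input $(x,y)$. $I(x,y)=y$ is the identity function. $TCC^\alpha_I(x,y)$ is the minimum of $CC^P(x,y)$ over all total protocols $P$ of complexity at most $\alpha$ that compute $I$ on all inputs of length $n$. A one-way protocol is one in which only Bob sends bits (to Alice). $TCC^\alpha_I(y)$ is the minimum of $CC^P(x,y)$ over all one-way total protocols $P$ of complexity at most $\alpha$ computing $I$ on all inputs of length $n$; this quantity does not depend on $x$. *)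

(* Defs.v *)
From Corelib Require Import BinNums PosDef.
From mathcomp Require Import all_boot.
From mathcomp Require Import boolp.

Set Implicit Arguments.
Unset Strict Implicit.
Unset Printing Implicit Defensive.

(** ** Minima of sets of natural numbers

   [None] stands for +oo, the minimum of the empty set. *)

Definition enat := option nat.

Definition le_enat (a b : enat) : bool :=
  match a, b with
  | _, None => true
  | None, Some _ => false
  | Some m, Some n => m <= n
  end.

Definition min_nat (S : nat -> Prop) : enat :=
  match pselect (exists k, `[< S k >]) with
  | left S_nonempty => Some (ex_minn S_nonempty)
  | right _ => None
  end.

(** ** Turing machines

   Deterministic machines with finitely many tapes over the alphabet
   {blank, 0, 1}; [None] is the blank. *)

Definition symbol := option bool.

Inductive move := MoveLeft | Stay | MoveRight.

Record TM := MkTM {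
  tapes : finType;
  prog_tape : tapes;
  cond_tape : tapes;
  out_tape : tapes;
  prog_neq_cond : prog_tape != cond_tape;
  states : finType;
  start : states;
  (* [None] means that the machine halts. *)
  delta : states -> {ffun tapes -> symbol} ->
          option (states * (tapes -> symbol * move))
}.

(* A pair [(l, r)]: [l] lists the cells to the left of the head, nearest
   first; [r] lists the scanned cell and the cells to its right.  Beyond both
   lists all cells are blank. *)
Definition tape := (seq symbol * seq symbol)%type.

Definition read (t : tape) : symbol := head None t.2.

Definition act (a : symbol * move) (t : tape) : tape :=
  match a.2 with
  | MoveLeft => (behead t.1, head None t.1 :: a.1 :: behead t.2)
  | Stay => (t.1, a.1 :: behead t.2)
  | MoveRight => (a.1 :: t.1, behead t.2)
  end.

Definition config (M : TM) := (states M * (tapes M -> tape))%type.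

Definition step (M : TM) (c : config M) : option (config M) :=
  match delta c.1 [ffun i => read (c.2 i)] with
  | None => None
  | Some (q, w) => Some (q, fun i => act (w i) (c.2 i))
  end.

Definition init (M : TM) (p z : seq bool) : config M :=
  (start M, fun i => ([::], if i == prog_tape M then map Some p
                            else if i == cond_tape M then map Some z
                            else [::])).

Fixpoint run_TM (M : TM) (fuel : nat) (c : config M) : option (config M) :=
  match step c with
  | None => Some c
  | Some c' => if fuel is k.+1 then run_TM k c' else None
  end.

Fixpoint bits_before_blank (r : seq symbol) : seq bool :=
  if r is Some b :: r' then b :: bits_before_blank r' else [::].

Definition output (M : TM) (c : config M) : seq bool :=
  bits_before_blank (c.2 (out_tape M)).2.

(* M halts on program p with condition z, and the output tape then holds s,
   read from the head rightwards up to the first blank. *)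
Definition prints (M : TM) (p z s : seq bool) : Prop :=
  exists k c, run_TM k (init M p z) = Some c /\ output c = s.

(* Every machine is simulated with at most a constant increase of the program
   length, the constant being independent of the condition. *)
Definition universal (U : TM) : Prop :=
  forall V : TM, exists c : nat, forall p z s : seq bool,
    prints V p z s -> exists2 q, prints U q z s & size q <= size p + c.

(** ** Plain conditional Kolmogorov complexity *)

Definition kolmogorov (U : TM) (s z : seq bool) : enat :=
  min_nat (fun l => exists2 p, prints U p z s & size p = l).

(* The standard bijection between numbers and strings: the binary expansion of
   n + 1, most significant bit first, without its leading 1. *)
Fixpoint pos_bits (p : positive) : seq bool :=
  match p with
  | xH => [::]
  | xO q => rcons (pos_bits q) false
  | xI q => rcons (pos_bits q) true
  end.

Definition str_of_nat (n : nat) : seq bool := pos_bits (Pos.of_succ_nat n).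

(** ** Communication protocols for strings of length n

   A protocol is a finite binary tree.  An inner node is owned by the party
   that sends the next bit and is labelled by the (partial) function giving
   that bit from the owner's input; the bit 0 leads to the first subtree, the
   bit 1 to the second.  A leaf is labelled by the (partial) function giving
   Alice's output from her input.  The value [None] of a label means that the
   party never answers, so that the protocol does not terminate. *)

Definition word (n : nat) := n.-tuple bool.

Inductive protocol (n : nat) :=
| Output of {ffun word n -> option (seq bool)}
| Alice of {ffun word n -> option bool} & protocol n & protocol n
| Bob of {ffun word n -> option bool} & protocol n & protocol n.

(* The transcript and Alice's output, if the protocol terminates. *)
Fixpoint run n (P : protocol n) (x y : word n) :
    option (seq bool * seq bool) :=
  match P with
  | Output g => omap (fun v => ([::], v)) (g x)
  | Alice a P0 P1 =>
      obind (fun b => omap (fun r => (b :: r.1, r.2))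
                           (if b then run P1 x y else run P0 x y)) (a x)
  | Bob a P0 P1 =>
      obind (fun b => omap (fun r => (b :: r.1, r.2))
                           (if b then run P1 x y else run P0 x y)) (a y)
  end.

Definition total n (P : protocol n) : Prop :=
  forall x y, exists r, run P x y = Some r.

Definition computes n (P : protocol n) (f : word n -> word n -> seq bool)
    : Prop :=
  forall x y, omap snd (run P x y) = Some (f x y).

(* The number CC^P(x,y) of bits exchanged, if the protocol terminates. *)
Definition CC n (P : protocol n) (x y : word n) : option nat :=
  omap (fun r => size r.1) (run P x y).

Fixpoint one_way n (P : protocol n) : bool :=
  match P with
  | Output _ => true
  | Alice _ _ _ => false
  | Bob _ P0 P1 => one_way P0 && one_way P1
  end.

(* The function I(x,y) = y: Alice has to learn the input of Bob. *)
Definition identity n (x y : word n) : seq bool := y.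

(** ** Complexity of protocols

   Protocols are finite objects; they are coded by strings in a self-delimiting
   way, a label being given by its table of values in lexicographic order of
   the arguments. *)

Fixpoint words (n : nat) : seq (word n) :=
  if n is m.+1 then
    [seq cons_tuple b w | b <- [:: false; true], w <- words m]
  else [:: [tuple]].

Definition enc_bool (b : bool) : seq bool := [:: b].

Definition enc_option T (e : T -> seq bool) (o : option T) : seq bool :=
  if o is Some a then true :: e a else [:: false].

Fixpoint enc_seq T (e : T -> seq bool) (s : seq T) : seq bool :=
  if s is a :: s' then true :: e a ++ enc_seq e s' else [:: false].

Definition enc_table n T (e : T -> seq bool) (f : {ffun word n -> option T})
    : seq bool :=
  enc_seq (enc_option e) [seq f w | w <- words n].

Fixpoint enc_protocol n (P : protocol n) : seq bool :=
  match P with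
  | Output g => [:: false; false] ++ enc_table (enc_seq enc_bool) g
  | Alice a P0 P1 =>
      [:: true; false] ++ enc_table enc_bool a
        ++ enc_protocol P0 ++ enc_protocol P1
  | Bob a P0 P1 =>
      [:: true; true] ++ enc_table enc_bool a
        ++ enc_protocol P0 ++ enc_protocol P1
  end.

(* C(P | n) *)
Definition protocol_complexity (U : TM) n (P : protocol n) : enat :=
  kolmogorov U (enc_protocol P) (str_of_nat n).

(** ** Communication complexity with total protocols *)

Definition TCC (U : TM) n (f : word n -> word n -> seq bool) (alpha : nat)
    (x y : word n) : enat :=
  min_nat (fun k => exists P : protocol n,
    [/\ total P, computes P f, le_enat (protocol_complexity U P) (Some alpha)
      & CC P x y = Some k]).

(* By [one_way_CC] below, [forall x] may equivalently be read [exists x]. *)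
Definition TCC_one_way (U : TM) n (f : word n -> word n -> seq bool)
    (alpha : nat) (y : word n) : enat :=
  min_nat (fun k => exists P : protocol n,
    [/\ one_way P, total P, computes P f,
        le_enat (protocol_complexity U P) (Some alpha)
      & forall x, CC P x y = Some k]).

Lemma one_way_CC n (P : protocol n) (x x' y : word n) :
  one_way P -> total P -> CC P x y = CC P x' y.
Proof.
move=> oneP totP; have [r /= rP] := totP x y; have [r' /= rP'] := totP x' y.
rewrite /CC rP rP' /=; congr (Some (size _)).
elim: P oneP r r' rP rP' {totP} => [g _|//|a P0 IH0 P1 IH1 /= /andP[o0 o1]] r r'.
  by rewrite /=; case: (g x) => //= v [<-]; case: (g x') => //= v' [<-].
case: (a y) => //= -[].
  case E: (run P1 x y) => [s|] //= [<-].
  by case E': (run P1 x' y) => [s'|] //= [<-] /=; rewrite (IH1 o1 _ _ E E').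
case E: (run P0 x y) => [s|] //= [<-].
by case E': (run P0 x' y) => [s'|] //= [<-] /=; rewrite (IH0 o0 _ _ E E').
Qed.

Lemma mem_words n (w : word n) : w \in words n.
Proof.
elim: n w => [|n IH] w; first by rewrite tuple0 /= inE; apply/eqP/val_inj.
case/tupleP: w => b w; apply/allpairsP; exists (b, w) => /=.
by split=> //; case: b; rewrite !inE.
Qed.

Definition prefix_inj T (e : T -> seq bool) : Prop :=
  forall a b u v, e a ++ u = e b ++ v -> a = b /\ u = v.

Lemma enc_bool_inj : prefix_inj enc_bool.
Proof. by move=> a b u v [-> ->]. Qed.

Lemma enc_option_inj T (e : T -> seq bool) :
  prefix_inj e -> prefix_inj (enc_option e).
Proof.
by move=> eI [a|] [b|] u v //= []; [move/eI=> [-> ->] | move=> ->].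
Qed.

Lemma enc_seq_inj T (e : T -> seq bool) :
  prefix_inj e -> prefix_inj (enc_seq e).
Proof.
move=> eI; elim=> [|a s IH] [|b t] u v //= []; first by move=> ->.
by rewrite -!catA => /eI[-> /IH[-> ->]].
Qed.

Lemma enc_table_inj n T (e : T -> seq bool) :
  prefix_inj e -> prefix_inj (@enc_table n T e).
Proof.
move=> eI f g u v /(enc_seq_inj (enc_option_inj eI))[fg ->]; split=> //.
apply/ffunP => w; have := mem_words w.
elim: (words n) fg => //= w' s IH [fg0 fg]; rewrite inE => /orP[/eqP->|] //.
exact: IH.
Qed.

(* Hence [enc_protocol] is injective: the code determines the protocol. *)
Lemma enc_protocol_inj n : prefix_inj (@enc_protocol n).
Proof.
elim=> [g|a P0 IH0 P1 IH1|a P0 IH0 P1 IH1] [g'|a' Q0 Q1|a' Q0 Q1] u v //=.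
- by case=> /(enc_table_inj (enc_seq_inj enc_bool_inj))[-> ->].
- by case; rewrite -!catA => /(enc_table_inj enc_bool_inj)[-> /IH0[-> /IH1[-> ->]]].
- by case; rewrite -!catA => /(enc_table_inj enc_bool_inj)[-> /IH0[-> /IH1[-> ->]]].
Qed.

(* Main.v *)
(* In a total protocol computing I, a transcript t and Alice's word x determine
   Bob's word.  For each y, let t(y) be a shortest transcript of a run on (x,y),
   over all x.  If t(y) = t(y'), then the leaf of t(y), being a combinatorial
   rectangle, contains (x,y) and (x,y') for some x, whence y = y'.  So Bob may
   send t(y) by himself, walking down the tree of P with all nodes given to
   him, and the leaf tells Alice what y is.  The new protocol is computable from
   P, so its complexity exceeds that of P by a constant only.

   For the last claim, a Turing machine must compute the code of the new
   protocol from that of P.  It runs U and then works with three stacks: the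
   output tape of U and two new tapes.  The functions between types with
   self-delimiting codes that can be computed in place on the top of a stack are
   closed under the usual list operations. *)

Require Import Defs.
From mathcomp Require Import all_boot.
From mathcomp Require boolp.

Set Implicit Arguments.
Unset Strict Implicit.
Unset Printing Implicit Defensive.

(** * Machine fragments over three stacks *)

(* A tape serves as a stack whose top is the scanned cell and which ends before
   the first blank on the right; the cells to the left of the head are
   irrelevant.  The stack [io] is to be the output tape of another machine. *)
Definition stack := option bool.
Notation main := (Some false) (only parsing).
Notation aux := (Some true) (only parsing).
Notation io := None (only parsing).

Record frag := Frag {
  fstate : finType;
  fstart : fstate;
  (* [None] is the exit of the fragment. *)
  fdelta : fstate -> (stack -> symbol) ->
           option fstate * (stack -> symbol * move)
}.

(** Both end states are of option type, so that a run, its exit included, can be transported into a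
    larger fragment. *)
Inductive reach (M : frag) :
    option (fstate M) -> (stack -> tape) ->
    option (fstate M) -> (stack -> tape) -> Prop :=
| reach_refl o c : reach o c o c
| reach_step q c o c' (d := fdelta q (fun k => read (c k))) :
    reach d.1 (fun k => act (d.2 k) (c k)) o c' -> reach (Some q) c o c'.

Definition store := (seq bool * seq bool * seq bool)%type.

Definition get (k : stack) (s : store) : seq bool :=
  match k with main => s.1.1 | aux => s.1.2 | io => s.2 end.

Definition set (k : stack) (v : seq bool) (s : store) : store :=
  match k with
  | main => (v, s.1.2, s.2)
  | aux => (s.1.1, v, s.2)
  | io => (s.1.1, s.1.2, v)
  end.

Definition contents (c : stack -> tape) : store :=
  (bits_before_blank (c main).2, bits_before_blank (c aux).2,
   bits_before_blank (c io).2).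

(** Quantifying over all tapes with the given contents ignores the cells to the left of the heads
    and those after the first blank, where old symbols may remain. *)
Variant exec (M : frag) (s s' : store) : Prop :=
  Exec of forall c, contents c = s ->
    exists2 c', reach (Some (fstart M)) c None c' & contents c' = s'.

Lemma get_contents k c : get k (contents c) = bits_before_blank (c k).2.
Proof. by case: k => [[]|]. Qed.

Lemma read_contents k c : read (c k) = ohead (get k (contents c)).
Proof. by rewrite get_contents /read; case: (c k).2 => [|[b|] r]. Qed.

(** A machine writes on every tape at every step, so an untouched stack rewrites its scanned symbol.
    On an empty list of cells this adds a blank; hence [contents] is preserved, but not always the
    tape itself. *)
Definition idle (r : stack -> symbol) (k : stack) : symbol * move :=
  (r k, Stay).

Lemma bits_idle t : bits_before_blank (act (read t, Stay) t).2 =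
  bits_before_blank t.2.
Proof. by case: t => l [|[b|] r]. Qed.

Lemma contents_idle c :
  contents (fun k => act (idle (fun k => read (c k)) k) (c k)) = contents c.
Proof. by congr (_, _, _); exact: bits_idle. Qed.

Lemma reach_trans (M : frag) (o1 o2 o3 : option (fstate M)) c1 c2 c3 :
  reach o1 c1 o2 c2 -> reach o2 c2 o3 c3 -> reach o1 c1 o3 c3.
Proof. by elim=> // q c o c' d _ IH /IH; exact: reach_step. Qed.

(** [h] says where the exit of [M] leads inside [N]: to the first state of the next fragment in
    [seqf], to the exit in [condf], back to the test in [whilef]. *)
Lemma reach_lift (M N : frag) (g : fstate M -> fstate N)
    (h : option (fstate M) -> option (fstate N)) :
  (forall q, h (Some q) = Some (g q)) ->
  (forall q r, fdelta (g q) r = (h (fdelta q r).1, (fdelta q r).2)) ->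
  forall o c o' c', reach o c o' c' -> reach (h o) c (h o') c'.
Proof.
move=> hS hD o c o' c'; elim=> [o1 c1|q c1 o1 c1' d _ IH].
  exact: reach_refl.
by rewrite hS; apply: reach_step; rewrite hD /=.
Qed.

(** The cell to the left of the head may hold an old symbol: the first step moves there, the second
    overwrites it. *)
Definition push (k : stack) (b : bool) : frag :=
  @Frag bool false (fun q r =>
    if q then (None, fun j => if j == k then (Some b, Stay) else idle r j)
    else (Some true, fun j => if j == k then (r j, MoveLeft) else idle r j)).

Lemma exec_push k b s : exec (push k b) s (set k (b :: get k s) s).
Proof.
split=> c <-; eexists.
  by apply: reach_step => /=; apply: reach_step => /=; exact: reach_refl.
have P t : bits_before_blank (act (Some b, Stay) (act (read t, MoveLeft) t)).2
    = b :: bits_before_blank t.2 by case: t => l [|[b'|] r].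
by case: k => [[]|]; congr (_, _, _);
  solve [exact: P | exact: etrans (bits_idle _) (bits_idle _)].
Qed.

Definition pop (k : stack) : frag :=
  @Frag unit tt (fun q r =>
    (None, fun j => if j == k then (r j, MoveRight) else idle r j)).

Lemma exec_pop k b v s : get k s = b :: v -> exec (pop k) s (set k v s).
Proof.
move=> ks; split=> c cs; eexists; first by apply: reach_step; exact: reach_refl.
have P t : bits_before_blank t.2 = b :: v ->
  bits_before_blank (act (read t, MoveRight) t).2 = v.
  by case: t => l [|[b'|] r] //= [].
move: ks; rewrite -{}cs.
by case: k => [[]|] /P Q; congr (_, _, _); solve [exact: Q | exact: bits_idle].
Qed.

Definition seqf (M N : frag) : frag :=
  @Frag (fstate M + fstate N)%type (inl (fstart M)) (fun q r =>
    match q with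
    | inl q => let d := fdelta q r in
        (Some (if d.1 is Some q' then inl q' else inr (fstart N)), d.2)
    | inr q => let d := fdelta q r in (omap inr d.1, d.2)
    end).

Lemma exec_seq M N s s' s'' :
  exec M s s' -> exec N s' s'' -> exec (seqf M N) s s''.
Proof.
case=> eM [eN]; split=> c /eM[c' rM /eN[c'' rN cs]]; exists c'' => //.
apply: (@reach_trans (seqf M N) _ (Some (inr (fstart N))) _ _ c').
  by apply: (reach_lift (N := seqf M N) (g := inl) (h := fun o =>
    Some (if o is Some q then inl q else inr (fstart N))) _ _ rM).
by apply: (reach_lift (N := seqf M N) (g := inr) (h := omap inr) _ _ rN).
Qed.

Definition condf (k : stack) (p : symbol -> bool) (M N : frag) : frag :=
  @Frag (option (fstate M + fstate N)) None (fun q r =>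
    match q with
    | None => (Some (Some (if p (r k) then inl (fstart M)
                           else inr (fstart N))), idle r)
    | Some (inl q) => let d := fdelta q r in (omap (Some \o inl) d.1, d.2)
    | Some (inr q) => let d := fdelta q r in (omap (Some \o inr) d.1, d.2)
    end).

Lemma exec_cond k (p : symbol -> bool) M N s s' :
  (if p (ohead (get k s)) then exec M s s' else exec N s s') ->
  exec (condf k p M N) s s'.
Proof.
move=> e; split=> c cs; rewrite -cs -read_contents in e.
have cs' := contents_idle c; rewrite cs in cs' e.
move: e; case: ifP => pk [/(_ _ cs')[c' r cc]]; exists c' => //;
  apply: reach_step; rewrite /= pk.
  exact: (reach_lift (N := condf k p M N) (g := Some \o inl)
    (h := omap (Some \o inl)) _ _ r).
exact: (reach_lift (N := condf k p M N) (g := Some \o inr)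
  (h := omap (Some \o inr)) _ _ r).
Qed.

(** [None] is the state of the loop test, so the exit of [M], which is also [None], becomes a return
    to the test. *)
Definition whilef (k : stack) (p : symbol -> bool) (M : frag) : frag :=
  @Frag (option (fstate M)) None (fun q r =>
    match q with
    | None => (if p (r k) then Some (Some (fstart M)) else None, idle r)
    | Some q => let d := fdelta q r in (Some d.1, d.2)
    end).

Lemma exec_while_stop k (p : symbol -> bool) M s :
  ~~ p (ohead (get k s)) -> exec (whilef k p M) s s.
Proof.
move=> /negPf pk; split=> c cs; rewrite -cs -read_contents in pk.
eexists; first by apply: reach_step; rewrite /= pk; exact: reach_refl.
by rewrite contents_idle.
Qed.

Lemma exec_while_loop k (p : symbol -> bool) M s s' s'' :
  p (ohead (get k s)) -> exec M s s' -> exec (whilef k p M) s' s'' ->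
  exec (whilef k p M) s s''.
Proof.
move=> pk [eM] [eW]; split=> c cs; rewrite -cs -read_contents in pk.
have cs' := contents_idle c; rewrite cs in cs'.
have [c1 r1 /eW[c2 r2 c2s]] := eM _ cs'; exists c2 => //.
apply: reach_step; rewrite /= pk; apply: reach_trans r2.
exact: (reach_lift (N := whilef k p M) (g := Some) (h := Some) _ _ r1).
Qed.

Definition skip : frag := whilef main (fun=> false) (pop main).

Lemma exec_skip s : exec skip s s.
Proof. exact: exec_while_stop. Qed.

Definition nonblank (a : symbol) : bool := isSome a.

Definition mvbit (k l : stack) : frag :=
  condf k (pred1 (Some true)) (seqf (pop k) (push l true))
    (seqf (pop k) (push l false)).

Lemma exec_mvbit k l b v s : get k s = b :: v ->
  exec (mvbit k l) s (set l (b :: get l (set k v s)) (set k v s)).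
Proof.
move=> ks; apply: exec_cond; rewrite ks /=.
by case: b ks => ks; apply: exec_seq (exec_pop ks) _; exact: exec_push.
Qed.

Definition pour (k l : stack) : frag := whilef k nonblank (mvbit k l).

Lemma exec_pour k l s : k != l ->
  exec (pour k l) s (set l (catrev (get k s) (get l s)) (set k [::] s)).
Proof.
move=> kl; move Ev: (get k s) => v; elim: v s Ev => [|b v IH] s Ev.
  have -> : set l (catrev [::] (get l s)) (set k [::] s) = s.
    case: s Ev => [[s a] i] /=.
    by case: k kl => [[]|]; case: l => [[]|] //= _ ->.
  by apply: exec_while_stop; rewrite Ev.
apply: exec_while_loop (exec_mvbit l Ev) _; first by rewrite Ev.
set s1 := set l _ _.
have -> : set l (catrev (b :: v) (get l s)) (set k [::] s) =
  set l (catrev v (get l s1)) (set k [::] s1).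
  by rewrite {}/s1; case: k l kl {IH Ev} => [[]|] [[]|].
by apply: IH; rewrite {}/s1; case: k l kl {Ev} => [[]|] [[]|].
Qed.

(** * Computable functions *)

(* Self-delimiting codes, together with a fragment that reads off the code on
   top of the main stack and reverses it onto the auxiliary one. *)
Class code (A : Type) := Code {
  enc : A -> seq bool;
  mover : frag;
  exec_mover : forall a u v w,
    exec mover (enc a ++ u, v, w) (u, catrev (enc a) v, w)
}.

Arguments mover A {_}.

Notation mv1 := (mvbit main aux).

Lemma exec_mv1 b u v w : exec mv1 (b :: u, v, w) (u, b :: v, w).
Proof. exact: (@exec_mvbit main aux b u). Qed.

Lemma exec_pop_main b u v w : exec (pop main) (b :: u, v, w) (u, v, w).
Proof. exact: (@exec_pop main b u). Qed.

Lemma exec_bool b u v w :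
  exec mv1 (enc_bool b ++ u, v, w) (u, catrev (enc_bool b) v, w).
Proof. exact: exec_mv1. Qed.

#[export] Instance code_bool : code bool := Code exec_bool.

Lemma exec_unit (a : unit) u v w :
  exec skip ((fun=> [::]) a ++ u, v, w) (u, catrev ((fun=> [::]) a) v, w).
Proof. exact: exec_skip. Qed.

#[export] Instance code_unit : code unit := Code exec_unit.

Definition option_mover A {cA : code A} : frag :=
  condf main (pred1 (Some true)) (seqf mv1 (mover A)) mv1.

Arguments option_mover A {_}.

Lemma exec_option A {cA : code A} (o : option A) u v w :
  exec (option_mover A) (enc_option enc o ++ u, v, w)
    (u, catrev (enc_option enc o) v, w).
Proof.
apply: exec_cond; case: o => [a|] /=; last exact: exec_mv1.
by apply: exec_seq (exec_mv1 _ _ _ _) _; exact: exec_mover.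
Qed.

#[export] Instance code_option A {cA : code A} : code (option A) :=
  Code (@exec_option A _).

Definition seq_mover A {cA : code A} : frag :=
  seqf (whilef main (pred1 (Some true)) (seqf mv1 (mover A))) mv1.

Arguments seq_mover A {_}.

Lemma exec_enc_seq A {cA : code A} (l : seq A) u v w :
  exec (seq_mover A) (enc_seq enc l ++ u, v, w)
    (u, catrev (enc_seq enc l) v, w).
Proof.
rewrite /seq_mover; set loop := whilef _ _ _.
set e := @enc A cA.
have catrev_enc : catrev (enc_seq e l) v =
    false :: behead (catrev (enc_seq e l) v).
  by elim: l v => //= a l IH v; rewrite catrev_catl -IH.
suff W : exec loop
    (enc_seq e l ++ u, v, w) (false :: u, behead (catrev (enc_seq e l) v), w).
  by apply: exec_seq W _; rewrite catrev_enc; exact: exec_mv1.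
elim: l v {catrev_enc} => [|a l IH] v; first exact: exec_while_stop.
apply: (@exec_while_loop _ _ _ _ (enc_seq e l ++ u,
  catrev (e a) (true :: v), w)) => //=.
  by rewrite -catA; apply: exec_seq (exec_mv1 _ _ _ _) (exec_mover _ _ _ _).
by rewrite catrev_catl; exact: IH.
Qed.

#[export] Instance code_seq A {cA : code A} : code (seq A) :=
  Code (@exec_enc_seq A _).

(** Numbers are coded in unary, as lists of units. *)
Lemma exec_nat n u v w :
  exec (seq_mover unit) (enc (nseq n tt) ++ u, v, w)
    (u, catrev (enc (nseq n tt)) v, w).
Proof. exact: exec_enc_seq. Qed.

#[export] Instance code_nat : code nat := Code exec_nat.

Lemma exec_prod A B {cA : code A} {cB : code B} (p : A * B) u v w :
  exec (seqf (mover A) (mover B)) ((enc p.1 ++ enc p.2) ++ u, v, w)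
    (u, catrev (enc p.1 ++ enc p.2) v, w).
Proof.
by rewrite -catA catrev_catl;
  apply: exec_seq (exec_mover _ _ _ _) (exec_mover _ _ _ _).
Qed.

#[export] Instance code_prod A B {cA : code A} {cB : code B} : code (A * B) :=
  Code (@exec_prod A B _ _).

Lemma enc_pair A B {cA : code A} {cB : code B} (a : A) (b : B) :
  enc (a, b) = enc a ++ enc b.
Proof. by []. Qed.

Definition enc_sum A B {cA : code A} {cB : code B} (s : A + B) : seq bool :=
  match s with inl a => false :: enc a | inr b => true :: enc b end.

Lemma exec_sum A B {cA : code A} {cB : code B} (s : A + B) u v w :
  exec (condf main (pred1 (Some true))
         (seqf mv1 (mover B)) (seqf mv1 (mover A)))
    (enc_sum s ++ u, v, w) (u, catrev (enc_sum s) v, w).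
Proof.
by apply: exec_cond; case: s => [a|b] /=;
  apply: exec_seq (exec_mv1 _ _ _ _) (exec_mover _ _ _ _).
Qed.

#[export] Instance code_sum A B {cA : code A} {cB : code B} : code (A + B) :=
  Code (@exec_sum A B _ _).

(** The rest [u] of the main stack survives, which allows a function to be applied to the first
    component of a pair; the other two stacks are scratch space, empty before and after. *)
Definition computable A B {cA : code A} {cB : code B} (f : A -> B) : Prop :=
  exists M, forall a u, exec M (enc a ++ u, [::], [::])
                               (enc (f a) ++ u, [::], [::]).

Lemma exec_drop A {cA : code A} a u v :
  exec (seqf (mover A) (whilef aux nonblank (pop aux)))
    (enc a ++ u, [::], v) (u, [::], v).
Proof.
apply: exec_seq (exec_mover _ _ _ _) _.
elim: (catrev _ _) => [|b w IH]; first exact: exec_while_stop.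
by apply: exec_while_loop IH => //; exact: (@exec_pop aux b).
Qed.

Lemma computable_ext A B {cA : code A} {cB : code B} (f g : A -> B) :
  f =1 g -> computable f -> computable g.
Proof. by move=> fg [M eM]; exists M => a u; rewrite -fg. Qed.

Lemma computable_id A {cA : code A} : computable (fun a : A => a).
Proof. by exists skip => a u; exact: exec_skip. Qed.

Lemma computable_comp A B D {cA : code A} {cB : code B} {cD : code D}
    (g : B -> D) (f : A -> B) :
  computable g -> computable f -> computable (fun a => g (f a)).
Proof.
move=> [N eN] [M eM]; exists (seqf M N) => a u.
exact: exec_seq (eM _ _) (eN _ _).
Qed.

Lemma computable_dup A {cA : code A} : computable (fun a : A => (a, a)).
Proof.
(* [mover] leaves the reversed code on [aux]; [both] copies each of its bits to [main] and [io], and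
   pouring through [aux] brings the second copy to [main]. *)
pose both := condf aux (pred1 (Some true))
  (seqf (pop aux) (seqf (push main true) (push io true)))
  (seqf (pop aux) (seqf (push main false) (push io false))).
exists (seqf (mover A) (seqf (whilef aux nonblank both)
  (seqf (pour io aux) (pour aux main)))) => a u.
have E w s t : exec (whilef aux nonblank both)
    (s, w, t) (catrev w s, [::], catrev w t).
  elim: w s t => [|b w IH] s t; first exact: exec_while_stop.
  apply: exec_while_loop (IH (b :: s) (b :: t)) => //.
  apply: exec_cond => /=; case: b => /=;
    apply: exec_seq; [exact: (@exec_pop aux true)| |
                      exact: (@exec_pop aux false)|];
    exact: exec_seq (exec_push _ _ _) (exec_push _ _ _).
apply: exec_seq (exec_mover _ _ _ _) _; apply: exec_seq (E _ _ _) _.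
apply: exec_seq (exec_pour (k := io) (l := aux) _ _) _ => //=.
rewrite -catA.
have -> : enc a ++ enc a ++ u =
  catrev (catrev (catrev (catrev (enc a) [::]) [::]) [::])
    (catrev (catrev (enc a) [::]) u).
  by rewrite !catrevE !cats0 !revK.
exact: (@exec_pour aux main (_, _, [::])).
Qed.

Lemma computable_swap A B {cA : code A} {cB : code B} :
  computable (fun p : A * B => (p.2, p.1)).
Proof.
(* The first code is parked on [io] while the second goes to [aux]; the first is then put on top of
   it, so that pouring [aux] into [main] exchanges the two. *)
exists (seqf (mover A) (seqf (pour aux io) (seqf (mover B)
  (seqf (pour io aux) (pour aux main))))) => -[a b] u.
rewrite !enc_pair -!catA.
apply: exec_seq (exec_mover _ _ _ _) _.
apply: exec_seq (exec_pour (k := aux) (l := io) _ _) _ => //=.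
apply: exec_seq (exec_mover _ _ _ _) _.
apply: exec_seq (exec_pour (k := io) (l := aux) _ _) _ => //=.
have -> : enc b ++ enc a ++ u =
  catrev (catrev (catrev (catrev (enc a) [::]) [::])
    (catrev (enc b) [::])) u.
  by rewrite !catrevE !cats0 revK rev_cat !revK catA.
exact: (@exec_pour aux main (_, _, [::])).
Qed.

Lemma computable_map1 A B D {cA : code A} {cB : code B} {cD : code D}
    (f : A -> B) :
  computable f -> computable (fun p : A * D => (f p.1, p.2)).
Proof.
move=> [M eM]; exists M => -[a d] u.
by rewrite !enc_pair -!catA.
Qed.

Lemma computable_pair A B D {cA : code A} {cB : code B} {cD : code D}
    (f : A -> B) (g : A -> D) :
  computable f -> computable g -> computable (fun a => (f a, g a)).
Proof.
move=> cf cg.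
(* The chain is [a], [(a, a)], [(f a, a)], [(a, f a)], [(g a, f a)], [(f a, g a)]. *)
have c1 := computable_comp (computable_map1 (D := A) cf) (@computable_dup A _).
have c2 := computable_comp (@computable_swap B A _ _) c1.
have c3 := computable_comp (computable_map1 (D := B) cg) c2.
exact: computable_comp (@computable_swap D B _ _) c3.
Qed.

Lemma computable_snd_proj A B {cA : code A} {cB : code B} :
  computable (@snd A B).
Proof.
eexists => -[a b] u; rewrite enc_pair -catA.
exact: exec_drop.
Qed.

Lemma computable_snd A B D {cA : code A} {cB : code B} {cD : code D}
    (f : A -> B * D) : computable f -> computable (fun a => (f a).2).
Proof. exact: computable_comp computable_snd_proj. Qed.

Lemma computable_fst_proj A B {cA : code A} {cB : code B} :
  computable (@fst A B).
Proof.
exact: (computable_comp (@computable_snd_proj B A _ _)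
  (@computable_swap A B _ _)).
Qed.

Lemma computable_fst A B D {cA : code A} {cB : code B} {cD : code D}
    (f : A -> B * D) : computable f -> computable (fun a => (f a).1).
Proof. exact: computable_comp computable_fst_proj. Qed.

(** Pushing fixed bits suffices. This covers the constructors, whose codes put a tag before the
    codes of their arguments. *)
Lemma computable_prefix A B {cA : code A} {cB : code B} (s : seq bool)
    (f : A -> B) :
  (forall a, enc (f a) = s ++ enc a) -> computable f.
Proof.
move=> fE; exists (foldr (fun b M => seqf M (push main b)) skip s) => a u.
rewrite fE; elim: s {fE} => [|b s IH] /=; first exact: exec_skip.
exact: exec_seq IH (exec_push main _ _).
Qed.

Lemma computable_const A B {cA : code A} {cB : code B} (b : B) :
  computable (fun _ : A => b).
Proof.
(* The code of [b] is pushed in front of that of [a], and the pair is then projected. *)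
apply: (computable_fst (f := fun a : A => (b, a))).
exact: (@computable_prefix _ _ _ _ (enc b)).
Qed.

Lemma computable_some A B {cA : code A} {cB : code B} (f : A -> B) :
  computable f -> computable (fun a => Some (f a)).
Proof.
by apply: computable_comp; exact: (@computable_prefix _ _ _ _ [:: true]).
Qed.

Lemma computable_inl A B D {cA : code A} {cB : code B} {cD : code D}
    (f : A -> B) : computable f -> computable (fun a => inl D (f a)).
Proof.
by apply: computable_comp; exact: (@computable_prefix _ _ _ _ [:: false]).
Qed.

Lemma computable_inr A B D {cA : code A} {cB : code B} {cD : code D}
    (f : A -> D) : computable f -> computable (fun a => inr B (f a)).
Proof.
by apply: computable_comp; exact: (@computable_prefix _ _ _ _ [:: true]).
Qed.

Lemma computable_cons A B {cA : code A} {cB : code B}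
    (f : A -> B) (g : A -> seq B) :
  computable f -> computable g -> computable (fun a => f a :: g a).
Proof.
move=> cf cg.
apply: (computable_comp (g := fun p => p.1 :: p.2)) (computable_pair cf cg).
exact: (@computable_prefix _ _ _ _ [:: true]).
Qed.

Lemma computable_succ A {cA : code A} (f : A -> nat) :
  computable f -> computable (fun a => (f a).+1).
Proof.
by apply: computable_comp; exact: (@computable_prefix _ _ _ _ [:: true]).
Qed.

(** Case analysis: the first bit of the code is the tag of the constructor, and popping it leaves
    the code of the arguments. *)
Lemma computable_branch A A0 A1 B
    {cA : code A} {cA0 : code A0} {cA1 : code A1} {cB : code B}
    (f : A -> B) (f0 : A0 -> B) (f1 : A1 -> B) :
  computable f0 -> computable f1 ->
  (forall a, (exists2 a0, enc a = false :: enc a0 & f a = f0 a0) \/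
             (exists2 a1, enc a = true :: enc a1 & f a = f1 a1)) ->
  computable f.
Proof.
move=> [M eM] [N eN] fE.
exists (condf main (pred1 (Some true)) (seqf (pop main) N)
                                    (seqf (pop main) M)) => a u.
apply: exec_cond.
by case: (fE a) => -[a' -> ->] /=; apply: exec_seq (exec_pop_main _ _ _ _) _.
Qed.

Lemma computable_if A B {cA : code A} {cB : code B} (b : A -> bool)
    (f g : A -> B) :
  computable b -> computable f -> computable g ->
  computable (fun a => if b a then f a else g a).
Proof.
move=> cb cf cg.
apply: (computable_comp (g := fun p : bool * A => if p.1 then f p.2 else g p.2)
  (f := fun a => (b a, a))); last by
  exact: computable_pair cb (@computable_id A _).
apply: (computable_branch cg cf) => -[[] a]; [right|left]; by exists a.
Qed.

Lemma computable_option A B D {cA : code A} {cB : code B} {cD : code D}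
    (o : A -> option B) (f : A -> B -> D) (g : A -> D) :
  computable o -> computable (fun p => f p.1 p.2) -> computable g ->
  computable (fun a => if o a is Some b then f a b else g a).
Proof.
move=> co cf cg.
apply: (computable_comp (g := fun p : option B * A =>
   if p.1 is Some b then f p.2 b else g p.2)
  (f := fun a => (o a, a))); last by
  exact: computable_pair co (@computable_id A _).
apply: (computable_branch cg (computable_comp cf computable_swap)).
by case=> -[b|] a; [right; exists (b, a)|left; exists a].
Qed.

Lemma computable_sum A B D E
    {cA : code A} {cB : code B} {cD : code D} {cE : code E}
    (s : A -> B + D) (f : A -> B -> E) (g : A -> D -> E) :
  computable s -> computable (fun p => f p.1 p.2) ->
  computable (fun p => g p.1 p.2) ->
  computable (fun a => match s a with inl b => f a b | inr d => g a d end).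
Proof.
move=> cs cf cg.
apply: (computable_comp (g := fun p : (B + D) * A =>
   match p.1 with inl b => f p.2 b | inr d => g p.2 d end)
  (f := fun a => (s a, a))); last by
  exact: computable_pair cs (@computable_id A _).
apply: (computable_branch (computable_comp cf computable_swap)
  (computable_comp cg computable_swap)).
by case=> -[b|d] a; [left; exists (b, a)|right; exists (d, a)].
Qed.

Lemma computable_case_seq A B D {cA : code A} {cB : code B} {cD : code D}
    (l : A -> seq B) (f : A -> D) (g : A -> B -> seq B -> D) :
  computable l -> computable f -> computable (fun p => g p.1 p.2.1 p.2.2) ->
  computable (fun a => match l a with
                       | [::] => f a
                       | b :: l' => g a b l'
                       end).
Proof.
move=> cl cf cg.
apply: (computable_comp (g := fun p : seq B * A =>
    match p.1 with [::] => f p.2 | b :: l' => g p.2 b l' end)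
  (f := fun a => (l a, a))); last by
  exact: computable_pair cl (@computable_id A _).
apply: (computable_branch cf (computable_comp cg computable_swap)).
case=> -[|b l'] a; [by left; exists a|by right; exists ((b, l'), a)].
Qed.

Ltac computability_step :=
  match goal with
  | H : computable _ |- _ => exact H
  | |- computable (fun a => a) => refine computable_id
  | |- computable fst => exact computable_fst_proj
  | |- computable snd => exact computable_snd_proj
  | |- computable (fun _ => ?b) => refine (computable_const b)
  | |- computable (fun a => (_, _)) => refine (computable_pair _ _)
  | |- computable (fun a => (_).1) => refine (computable_fst _)
  | |- computable (fun a => (_).2) => refine (computable_snd _)
  | |- computable (fun a => _ :: _) => refine (computable_cons _ _)
  | |- computable (fun a => Some _) => refine (computable_some _)
  | |- computable (fun a => _.+1) => refine (computable_succ _)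
  | |- computable (fun a => inl _) => refine (computable_inl _)
  | |- computable (fun a => inr _) => refine (computable_inr _)
  | |- computable (fun a => if _ then _ else _) => refine (computable_if _ _ _)
  end.

Ltac computability := cbv beta; repeat (computability_step; cbv beta).

(** * Closure under folds, iteration and list operations *)

Lemma computable_foldl A B D {cA : code A} {cB : code B} {cD : code D}
    (f : A -> D -> B -> D) (z : A -> D) (l : A -> seq B) :
  computable (fun p : A * (D * B) => f p.1 p.2.1 p.2.2) ->
  computable z -> computable l ->
  computable (fun a => foldl (f a) (z a) (l a)).
Proof.
move=> cf cz cl.
(* The loop keeps the remaining list, the accumulator and the parameter on the stack. *)
pose body (q : B * (seq B * (D * A))) : seq B * (D * A) :=
  (q.2.1, (f q.2.2.2 q.2.2.1 q.1, q.2.2.2)).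
assert (cb : computable body).
  rewrite /body; computability.
  by apply: (computable_comp (f := fun q : B * (seq B * (D * A)) =>
    (q.2.2.2, (q.2.2.1, q.1))) cf); computability.
pose loop (p : seq B * (D * A)) : seq B * (D * A) :=
  ([::], (foldl (f p.2.2) p.2.1 p.1, p.2.2)).
assert (cL : computable loop).
  case: cb => M eM.
  (* The bit on top tells whether the list is nonempty; popping a [true] turns the code of
     [(b :: l', (d, a))] into that of [(b, (l', (d, a)))], the argument of [body]. *)
  exists (whilef main (pred1 (Some true)) (seqf (pop main) M)).
  case=> l' [d a] u; elim: l' d => [|b l' IH] d; first exact: exec_while_stop.
  apply: exec_while_loop (IH (f a d b)) => //.
  have -> : enc (b :: l', (d, a)) ++ u = true :: (enc (b, (l', (d, a))) ++ u).
    by rewrite !enc_pair /= -!catA.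
  exact: exec_seq (exec_pop_main _ _ _ _) (eM _ _).
assert (cI : computable (fun a => (l a, (z a, a)))) by computability.
exact: computable_fst (computable_snd (computable_comp cL cI)).
Qed.

Lemma computable_catrev A B {cA : code A} {cB : code B} (f g : A -> seq B) :
  computable f -> computable g -> computable (fun a => catrev (f a) (g a)).
Proof.
move=> cf cg.
apply: (@computable_ext _ _ _ _
  (fun a => foldl (fun t x => x :: t) (g a) (f a))) => [a|].
  by elim: (f a) (g a) => /=.
by refine (computable_foldl _ _ _); computability.
Qed.

Lemma computable_rev A B {cA : code A} {cB : code B} (f : A -> seq B) :
  computable f -> computable (fun a => rev (f a)).
Proof.
by move=> cf; refine (computable_catrev (g := fun=> [::]) _ _); computability.
Qed.

Lemma computable_cat A B {cA : code A} {cB : code B} (f g : A -> seq B) :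
  computable f -> computable g -> computable (fun a => f a ++ g a).
Proof.
move=> cf cg.
apply: (@computable_ext _ _ _ _ (fun a => catrev (rev (f a)) (g a))) => [a|].
  by rewrite catrevE revK.
by refine (computable_catrev (computable_rev _) _).
Qed.

Lemma computable_foldr A B D {cA : code A} {cB : code B} {cD : code D}
    (f : A -> B -> D -> D) (z : A -> D) (l : A -> seq B) :
  computable (fun p : A * (D * B) => f p.1 p.2.2 p.2.1) ->
  computable z -> computable l ->
  computable (fun a => foldr (f a) (z a) (l a)).
Proof.
move=> cf cz cl.
apply: (@computable_ext _ _ _ _
  (fun a => foldl (fun t x => f a x t) (z a) (rev (l a)))) => [a|].
  by rewrite foldl_rev.
by refine (computable_foldl _ _ (computable_rev _)); computability.
Qed.

Lemma computable_map A B D {cA : code A} {cB : code B} {cD : code D}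
    (f : A -> B -> D) (l : A -> seq B) :
  computable (fun p => f p.1 p.2) -> computable l ->
  computable (fun a => [seq f a x | x <- l a]).
Proof.
move=> cf cl.
apply: (@computable_ext _ _ _ _
  (fun a => foldr (fun x t => f a x :: t) [::] (l a))) => [a|] //.
refine (computable_foldr _ _ _); computability.
by refine (computable_comp (f := fun p => (p.1, p.2.2)) cf _); computability.
Qed.

Lemma computable_pmap_id A B {cA : code A} {cB : code B}
    (l : A -> seq (option B)) :
  computable l -> computable (fun a => pmap id (l a)).
Proof.
move=> cl; apply: (@computable_ext _ _ _ _
  (fun a => foldr (fun x t => if x is Some b then b :: t else t) [::] (l a))).
  by move=> a; elim: (l a) => //= -[b|] t ->.
refine (computable_foldr _ _ _); computability.
by refine (computable_option _ _ _); computability.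
Qed.

Lemma computable_head A B {cA : code A} {cB : code B} d (l : A -> seq B) :
  computable l -> computable (fun a => head d (l a)).
Proof. by move=> cl; refine (computable_case_seq _ _ _); computability. Qed.

Lemma computable_ohead A B {cA : code A} {cB : code B} (l : A -> seq B) :
  computable l -> computable (fun a => ohead (l a)).
Proof. by move=> cl; refine (computable_case_seq _ _ _); computability. Qed.

Lemma computable_behead A B {cA : code A} {cB : code B} (l : A -> seq B) :
  computable l -> computable (fun a => behead (l a)).
Proof. by move=> cl; refine (computable_case_seq _ _ _); computability. Qed.

Lemma computable_size A B {cA : code A} {cB : code B} (l : A -> seq B) :
  computable l -> computable (fun a => size (l a)).
Proof.
move=> cl; apply: (@computable_ext _ _ _ _
  (fun a => foldr (fun _ n => n.+1) 0 (l a))) => [a|].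
  by elim: (l a) => //= _ t ->.
by refine (computable_foldr _ _ _); computability.
Qed.

(** Both values have the same code, so nothing has to be done. *)
Lemma computable_units A {cA : code A} (n : A -> nat) :
  computable n -> computable (fun a => nseq (n a) tt).
Proof. by apply: computable_comp; exists skip => a u; exact: exec_skip. Qed.

Lemma computable_iter A D {cA : code A} {cD : code D}
    (n : A -> nat) (f : A -> D -> D) (z : A -> D) :
  computable n -> computable (fun p => f p.1 p.2) -> computable z ->
  computable (fun a => iter (n a) (f a) (z a)).
Proof.
move=> cn cf cz; apply: (@computable_ext _ _ _ _
  (fun a => foldr (fun _ => f a) (z a) (nseq (n a) tt))) => [a|].
  by elim: (n a) => //= m ->.
refine (computable_foldr _ _ _); last exact: computable_units cn.
  by refine (computable_comp (f := fun p => (p.1, p.2.1)) cf _); computability.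
by [].
Qed.

Lemma computable_nth A B {cA : code A} {cB : code B} d
    (l : A -> seq B) (n : A -> nat) :
  computable l -> computable n -> computable (fun a => nth d (l a) (n a)).
Proof.
move=> cl cn; apply: (@computable_ext _ _ _ _
  (fun a => head d (iter (n a) behead (l a)))) => [a|].
  by elim: (n a) (l a) => [|m IH] [|x t] //; rewrite iterSr IH ?nth_nil.
refine (computable_head _ (computable_iter _ _ _)) => //.
by refine (computable_behead _); computability.
Qed.

Lemma computable_iota0 A {cA : code A} (n : A -> nat) :
  computable n -> computable (fun a => iota 0 (n a)).
Proof.
move=> cn; apply: (@computable_ext _ _ _ _
  (fun a => iter (n a) (fun l => l ++ [:: size l]) [::])) => [a|].
  by elim: (n a) => // m IH; rewrite iterS IH -[in RHS]addn1 iotaD size_iota.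
refine (computable_iter cn _ _); computability.
refine (computable_cat _ _); computability.
by refine (computable_size _); computability.
Qed.

Lemma computable_eqb A {cA : code A} (b c : A -> bool) :
  computable b -> computable c -> computable (fun a => b a == c a).
Proof.
move=> cb cc; apply: (@computable_ext _ _ _ _
  (fun a => if b a then c a else if c a then false else true)) => [a|].
  by case: (b a); case: (c a).
by computability.
Qed.

Lemma computable_leq_size A B D {cA : code A} {cB : code B} {cD : code D}
    (s : A -> seq B) (t : A -> seq D) :
  computable s -> computable t ->
  computable (fun a => size (s a) <= size (t a)).
Proof.
(* Dropping [size (t a)] entries from [s a] must leave nothing. *)
move=> cs ct; apply: (@computable_ext _ _ _ _ (fun a =>
  if ohead (iter (size (t a)) behead (s a)) is Some _ then false else true)).
  move=> a; elim: (size (t a)) (s a) => [|m IH] [|x l] //=.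
    by have -> : iter m behead [::] = [::] :> seq B by elim: m {IH} => //= m ->.
  by rewrite -[behead _]/(iter m.+1 behead (x :: l)) iterSr IH.
refine (computable_option _ _ _); computability.
refine (computable_ohead (computable_iter (computable_size _) _ _)) => //.
by refine (computable_behead _); computability.
Qed.

Ltac computability_step ::=
  match goal with
  | H : computable _ |- _ => exact H
  | H : computable ?f |- computable (fun a => ?f _) =>
      refine (computable_comp H _)
  | |- computable (fun a => a) => refine computable_id
  | |- computable fst => exact computable_fst_proj
  | |- computable snd => exact computable_snd_proj
  | |- computable (fun _ => ?b) => refine (computable_const b)
  | |- computable (fun a => (_, _)) => refine (computable_pair _ _)
  | |- computable (fun a => (_).1) => refine (computable_fst _)
  | |- computable (fun a => (_).2) => refine (computable_snd _)
  | |- computable (fun a => _ :: _) => refine (computable_cons _ _)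
  | |- computable (fun a => Some _) => refine (computable_some _)
  | |- computable (fun a => inl _) => refine (computable_inl _)
  | |- computable (fun a => inr _) => refine (computable_inr _)
  | |- computable (fun a => if _ then _ else _) => refine (computable_if _ _ _)
  | |- computable (fun a => rev _) => refine (computable_rev _)
  | |- computable (fun a => [seq _ | x <- _]) => refine (computable_map _ _)
  | |- computable (fun a => foldl _ _ _) => refine (computable_foldl _ _ _)
  | |- computable (fun a => pmap id _) => refine (computable_pmap_id _)
  | |- computable (fun a => head _ _) => refine (computable_head _ _)
  | |- computable (fun a => ohead _) => refine (computable_ohead _)
  | |- computable (fun a => nth _ _ _) => refine (computable_nth _ _ _)
  | |- computable (fun a => size _) => refine (computable_size _)
  | |- computable (fun a => iota 0 _) => refine (computable_iota0 _)
  | |- computable (fun a => size _ <= size _) =>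
      refine (computable_leq_size _ _)
  | |- computable (fun a => _ == _) => refine (computable_eqb _ _)
  | _ => first [ refine (computable_option _ _ _)
               | refine (computable_sum _ _ _)
               | refine (computable_case_seq _ _ _) ]
  end.

(** * From fragments to Turing machines *)

Lemma catrev_nilK (s : seq bool) : catrev (catrev s [::]) [::] = s.
Proof. by rewrite !catrevE !cats0 revK. Qed.

(** The output of [U] is a bare concatenation of codes; the parser inserts the markers that make it
    the code of a list. The end is recognised by a blank, which is why no code may be empty. *)
Definition parser A {cA : code A} : frag :=
  seqf (pour io aux) (seqf (pour aux main)
  (seqf (whilef main nonblank (seqf (push aux true) (mover A)))
    (seqf (push aux false) (pour aux main)))).

Lemma exec_parser A {cA : code A} (l : seq A) :
  (forall a : A, enc a <> [::]) ->
  exec parser ([::], [::], flatten (map enc l)) (enc l, [::], [::]).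
Proof.
move=> enc_neq0.
apply: exec_seq (exec_pour (k := io) (l := aux) _ _) _ => //=.
apply: exec_seq (exec_pour (k := aux) (l := main) _ _) _ => //=.
rewrite catrev_nilK; set e := @enc A cA.
pose w := catrev (flatten [seq true :: e a | a <- l]) [::].
have wE : catrev (enc_seq e l) [::] = false :: w.
  rewrite /w; elim: l [::] {w} => //= a l IH v; rewrite !catrev_catl; exact: IH.
apply: (@exec_seq _ _ _ ([::], w, [::])).
  suff: forall v, exec
    (whilef main nonblank (seqf (push aux true) (@mover A cA)))
    (flatten (map e l), v, [::])
    ([::], catrev (flatten [seq true :: e a | a <- l]) v, [::]) by exact.
  elim: l {w wE} => [|a l IH] v /=; first exact: exec_while_stop.
  rewrite catrev_catl; apply: exec_while_loop (IH _) => //=.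
    by have := enc_neq0 a; rewrite -/e; case: (e a).
  by apply: exec_seq (exec_push aux _ _) _; exact: exec_mover.
apply: exec_seq (exec_push aux _ _) _ => /=.
rewrite -wE -[enc_seq _ _ in X in exec _ _ X]catrev_nilK.
exact: (@exec_pour aux main ([::], _, [::])).
Qed.

Definition unparser A {cA : code A} : frag :=
  seqf (whilef main (pred1 (Some true)) (seqf (pop main) (mover A)))
    (seqf (pop main) (pour aux main)).

Lemma exec_unparser A {cA : code A} (l : seq A) :
  exec unparser (enc l, [::], [::]) (flatten (map enc l), [::], [::]).
Proof.
set e := @enc A cA; pose w := catrev (flatten (map e l)) [::].
apply: (@exec_seq _ _ _ ([:: false], w, [::])).
  suff: forall v, exec
      (whilef main (pred1 (Some true)) (seqf (pop main) (@mover A cA)))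
      (@enc _ (@code_seq A cA) l, v, [::])
      ([:: false], catrev (flatten (map e l)) v, [::]) by exact.
  elim: l {w} => [|b l IH] v /=; first exact: exec_while_stop.
  rewrite catrev_catl; apply: exec_while_loop (IH _) => //.
  by apply: exec_seq (exec_pop_main _ _ _ _) _; exact: exec_mover.
apply: exec_seq (exec_pop_main _ _ _ _) _.
rewrite -[flatten _]catrev_nilK.
exact: (@exec_pour aux main ([::], w, [::])).
Qed.

Lemma exec_flatten A B {cA : code A} {cB : code B} (f : seq A -> seq B) :
  (forall a : A, enc a <> [::]) -> computable f ->
  exists M, forall l : seq A,
    exec M ([::], [::], flatten (map enc l))
           (flatten (map enc (f l)), [::], [::]).
Proof.
move=> enc_neq0 [M eM].
exists (seqf (@parser A _) (seqf M (@unparser B _))) => l.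
apply: exec_seq (exec_parser _ enc_neq0) _.
have := eM l [::]; rewrite !cats0 => /exec_seq; apply; exact: exec_unparser.
Qed.

(** The two added tapes are the stacks [main] ([inr false]) and [aux] ([inr true]), and the output
    tape of [U] is [io]. Where [U] would halt, one idle step hands over to [M], whose result is read
    from [main]. *)
Definition postcompose (U : TM) (M : frag) : TM :=
  @MkTM (tapes U + bool)%type
    (inl (prog_tape U)) (inl (cond_tape U)) (inr false) (prog_neq_cond U)
    (states U + option (fstate M))%type (inl (start U))
    (fun q r =>
      match q with
      | inl q =>
          match delta q [ffun t => r (inl t)] with
          | Some (q', w) =>
              Some (inl q', fun t => match t with
                                     | inl t => w t
                                     | inr b => (r (inr b), Stay)
                                     end)
          | None => Some (inr (Some (fstart M)), fun t => (r t, Stay))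
          end
      | inr (Some q) =>
          let d := fdelta q (fun k => r (if k is Some b then inr b
                                         else inl (out_tape U))) in
          Some (inr d.1, fun t =>
            match t with
            | inl t => if t == out_tape U then d.2 None else (r (inl t), Stay)
            | inr b => d.2 (Some b)
            end)
      | inr None => None
      end).

Definition halts (M : TM) (c c' : config M) : Prop :=
  exists k, run_TM k c = Some c'.

Lemma halts_stop M (c : config M) : step c = None -> halts c c.
Proof. by move=> s; exists 0; rewrite /= s. Qed.

Lemma halts_step M (c c' c'' : config M) :
  step c = Some c' -> halts c' c'' -> halts c c''.
Proof. by move=> s [k r]; exists k.+1; rewrite /= s. Qed.

Definition frag_tapes U M (c : tapes (postcompose U M) -> tape) (k : stack) :=
  c (if k is Some b then inr b else inl (out_tape U)).

(** Only the three stack tapes are tracked; the other tapes of [U] merely idle. *)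
Lemma reach_halts U M o o' (c c' : stack -> tape) :
  @reach M o c o' c' -> o' = None ->
  forall d : tapes (postcompose U M) -> tape, frag_tapes d =1 c ->
    exists2 d', halts ((inr o, d) : config (postcompose U M)) (inr None, d')
      & frag_tapes d' =1 c'.
Proof.
elim=> [{}o {}c -> d dc|q {}c {}o' {}c' e _ IH o'N d dc].
  by exists d => //; exact: halts_stop.
have eE : fdelta q (fun k => read (frag_tapes d k)) = e.
  by rewrite /e; congr fdelta; apply: boolp.funext => k; rewrite dc.
pose d1 (t : tapes (postcompose U M)) := act (match t with
  | inl t => if t == out_tape U then e.2 None else (read (d (inl t)), Stay)
  | inr b => e.2 (Some b) end) (d t).
have [|d' hd' d'c] := IH o'N d1.
  by case=> [b|]; rewrite -dc /frag_tapes /d1 ?eqxx.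
exists d' => //; apply: halts_step hd'; rewrite /step /=.
have -> : (fun k : stack => [ffun t => read (d t)]
    (if k is Some b then inr b else inl (out_tape U))) =
    (fun k => read (frag_tapes d k)).
  by apply: boolp.funext => k; rewrite ffunE.
rewrite eE; congr (Some (_, _)); apply: boolp.funext => t.
by rewrite /d1; case: t => [t|b] //; rewrite ffunE.
Qed.

Lemma prints_postcompose U M p z (s t : seq bool) :
  prints U p z s -> exec M ([::], [::], s) (t, [::], [::]) ->
  prints (postcompose U M) p z t.
Proof.
move=> [k [c [rc <-]]] [eM].
suff [d hd od] : exists2 d, halts (init (postcompose U M) p z) d & output d = t.
  by case: hd => k' rk'; exists k', d.
suff H : forall (c0 : config U) (d0 : tapes (postcompose U M) -> tape),
    run_TM k c0 = Some c -> (forall t, d0 (inl t) = c0.2 t) ->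
    (forall b, bits_before_blank (d0 (inr b)).2 = [::]) ->
    exists2 d, halts ((inl c0.1, d0) : config (postcompose U M)) d
      & output d = t by exact: (H _ _ rc).
have readE (c0 : config U) (d0 : tapes (postcompose U M) -> tape) :
    (forall t, d0 (inl t) = c0.2 t) ->
    [ffun t => [ffun t' => read (d0 t')] (inl t)] = [ffun t => read (c0.2 t)].
  by move=> dE; apply/ffunP => t'; rewrite !ffunE dE.
(* The hand-over may add blanks to the tapes, but [eM] holds for all tapes with the same
   contents. *)
have last_step (d0 : tapes (postcompose U M) -> tape) :
    step c = None -> (forall t, d0 (inl t) = c.2 t) ->
    (forall b, bits_before_blank (d0 (inr b)).2 = [::]) ->
    exists2 d, halts ((inl c.1, d0) : config (postcompose U M)) d
      & output d = t.
  move=> sc dE d0E.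
  pose d1 (t : tapes (postcompose U M)) := act (read (d0 t), Stay) (d0 t).
  have d1E : contents (frag_tapes d1) = ([::], [::], output c).
    by rewrite /contents /frag_tapes /d1 !bits_idle !d0E dE.
  have [c' rM c'E] := eM _ d1E.
  have [d hd dE'] := reach_halts rM erefl (fun=> erefl).
  exists (inr None, d).
    apply: halts_step hd; move: sc; rewrite /step /= (readE c) //.
    case: (delta _ _) => [[]|] // _; congr (Some (_, _)).
    by apply: boolp.funext => t'; rewrite ffunE.
  have := congr1 (get main) c'E; rewrite get_contents /= => <-.
  by rewrite -dE'.
elim: k {rc} => [|k IH] c0 d0 /=; case E: (step c0) => [c1|] //.
- by case=> c0E; move: E; rewrite c0E; exact: last_step.
- move=> rc dE d0E; move: E; rewrite /step.
  case E: (delta _ _) => [[q w]|] // [c1E].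
  pose d1 (t : tapes (postcompose U M)) := act (match t with
    | inl t => w t | inr b => (read (d0 (inr b)), Stay) end) (d0 t).
  have [t'|b|d hd od] := IH c1 d1 rc.
  + by rewrite -c1E /= /d1 dE.
  + by rewrite /d1 bits_idle d0E.
  exists d => //; apply: halts_step hd; rewrite /step /= (readE c0) // E -c1E.
  congr (Some (_, _)); apply: boolp.funext => -[t'|b] //.
  by rewrite ffunE.
- by case=> c0E; move: E; rewrite c0E; exact: last_step.
Qed.

(** * Conversion of protocols *)

(* A node with its table, in preorder.  The bit of an inner node tells whether
   it is Bob's; that of a leaf is always [false], so that the codes of the
   tokens concatenate to that of the protocol. *)
Definition token :=
  (bool * seq (option (seq bool)) + bool * seq (option bool))%type.

(* One step of a preorder traversal that passes attributes down the tree; the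
   first list holds the attributes of the pending subtrees. *)
Definition visit A O (emit : A -> token -> O) (down : bool -> A -> token -> A)
    (st : seq A * seq O) (t : token) : seq A * seq O :=
  match st.1 with
  | [::] => st
  | a :: l => (match t with
               | inl _ => l
               | inr _ => down false a t :: down true a t :: l
               end, emit a t :: st.2)
  end.

Definition traverse A O (emit : A -> token -> O)
    (down : bool -> A -> token -> A) (a : A) (ts : seq token) : seq O :=
  rev (foldl (visit emit down) ([:: a], [::]) ts).2.

Lemma computable_traverse E A O {cE : code E} {cA : code A} {cO : code O}
    (emit : E -> A -> token -> O) (down : E -> bool -> A -> token -> A)
    (a : E -> A) (ts : E -> seq token) :
  computable (fun p => emit p.1 p.2.1 p.2.2) ->
  (forall b, computable (fun p => down p.1 b p.2.1 p.2.2)) ->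
  computable a -> computable ts ->
  computable (fun e => traverse (emit e) (down e) (a e) (ts e)).
Proof.
move=> ce cd ca cts; rewrite /traverse /visit; computability.
- by refine (computable_comp
    (f := fun p => (p.1.1.1, (p.1.2.1, p.1.1.2.2))) (cd false) _);
  computability.
- by refine (computable_comp
    (f := fun p => (p.1.1.1, (p.1.2.1, p.1.1.2.2))) (cd true) _);
  computability.
- by refine (computable_comp
    (f := fun p => (p.1.1, (p.2.1, p.1.2.2))) ce _); computability.
Qed.

(* The run on the i-th word of Alice and the j-th word of Bob; the attribute of
   a node is the reversed path to it if the run passes through it. *)
Definition sim_emit (i : nat) (a : option (seq bool)) (t : token) :
    option (seq bool * seq bool) :=
  match t with
  | inl g => if a is Some s
             then Some (s, if nth None g.2 i is Some w then w else [::])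
             else None
  | inr _ => None
  end.

Definition sim_down (i j : nat) (b : bool) (a : option (seq bool)) (t : token) :
    option (seq bool) :=
  match t with
  | inl _ => None
  | inr f => if a is Some s then
               if nth None f.2 (if f.1 then j else i) is Some c then
                 if c == b then Some (b :: s) else None
               else None
             else None
  end.

(** Only the leaf reached by a terminating run emits a value, so the filtered list has a single
    entry: the reversed transcript with the output. *)
Definition simulate (i j : nat) (ts : seq token) : seq bool * seq bool :=
  head ([::], [::])
    (pmap id (traverse (sim_emit i) (sim_down i j) (Some [::]) ts)).

Lemma computable_simulate E {cE : code E} (i j : E -> nat)
    (ts : E -> seq token) :
  computable i -> computable j -> computable ts ->
  computable (fun e => simulate (i e) (j e) (ts e)).
Proof.
move=> ci cj cts; rewrite /simulate; computability.
refine (computable_traverse _ _ _ _); last 2 first.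
- by computability.
- by computability.
- by rewrite /sim_emit; computability.
- by move=> b; rewrite /sim_down; computability.
Qed.

Definition shorter (r r' : seq bool * seq bool) : seq bool * seq bool :=
  if size r.1 <= size r'.1 then r else r'.

Definition best (ts : seq token) (idx : seq nat) (j : nat) :
    seq bool * seq bool :=
  foldl (fun r i => shorter r (simulate i j ts)) (simulate 0 j ts) idx.

(* An entry of an attribute is, for a word of Bob whose message passes through
   the node, the rest of the message and the word. *)
Definition bob_emit (a : seq (option (seq bool * seq bool))) (t : token) :
    token :=
  match t with
  | inl _ =>
      inl (false, [seq Some (head ([::], [::]) (pmap id a)).2 | _ <- a])
  | inr _ =>
      inr (true, [seq if e is Some q then ohead q.1 else None | e <- a])
  end.

Definition advance (b : bool) (e : option (seq bool * seq bool)) :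
    option (seq bool * seq bool) :=
  if e is Some q then
    if q.1 is c :: s then if c == b then Some (s, q.2) else None else None
  else None.

Definition bob_down (b : bool) (a : seq (option (seq bool * seq bool)))
    (t : token) : seq (option (seq bool * seq bool)) :=
  [seq advance b e | e <- a].

(** The conversion is not given [n]: the number of words is read off the length of the table at the
    root. *)
Definition indices (ts : seq token) : seq nat :=
  if ts is t :: _ then
    iota 0 (match t with inl g => size g.2 | inr f => size f.2 end)
  else [::].

(** At the root every word of Bob has an entry. Transcripts come reversed from [simulate], hence the
    [rev]. *)
Definition convert (ts : seq token) : seq token :=
  traverse bob_emit bob_down
    [seq (let r := best ts (indices ts) j in Some (rev r.1, r.2))
    | j <- indices ts] ts.

Lemma computable_indices E {cE : code E} (ts : E -> seq token) :
  computable ts -> computable (fun e => indices (ts e)).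
Proof. by move=> cts; rewrite /indices; computability. Qed.

Lemma computable_best E {cE : code E} (ts : E -> seq token) (j : E -> nat) :
  computable ts -> computable j ->
  computable (fun e => best (ts e) (indices (ts e)) (j e)).
Proof.
move=> cts cj.
refine (computable_foldl (f := fun e r i => shorter r (simulate i (j e) (ts e)))
  _ _ _); last exact: computable_indices.
- assert (cs : computable (fun p : E * ((seq bool * seq bool) * nat) =>
    simulate p.2.2 (j p.1) (ts p.1))).
    by refine (computable_simulate _ _ _); computability.
  by rewrite /shorter; computability.
- by refine (computable_simulate _ _ _); computability.
Qed.

Lemma computable_convert : computable convert.
Proof.
refine (computable_traverse (emit := fun=> bob_emit) (down := fun=> bob_down)
  _ _ _ _); last by computability.
- by rewrite /bob_emit; computability.
- by move=> b; rewrite /bob_down /advance; computability.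
- refine (computable_map _ _); last first.
    by refine (computable_indices _); computability.
  assert (cb : computable (fun p : seq token * nat =>
    best p.1 (indices p.1) p.2)).
    by refine (computable_best _ _); computability.
  by cbv zeta; computability.
Qed.

(** * Token lists of protocols and the meaning of the traversals *)

Fixpoint tokens n (P : protocol n) : seq token :=
  match P with
  | Output g => [:: inl (false, [seq g w | w <- words n])]
  | Alice a P0 P1 =>
      inr (false, [seq a w | w <- words n]) :: tokens P0 ++ tokens P1
  | Bob a P0 P1 =>
      inr (true, [seq a w | w <- words n]) :: tokens P0 ++ tokens P1
  end.

Lemma enc_protocol_tokens n (P : protocol n) :
  enc_protocol P = flatten (map enc (tokens P)).
Proof.
elim: P => [g|a P0 IH0 P1 IH1|a P0 IH0 P1 IH1] /=; first by rewrite cats0.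
- by rewrite map_cat flatten_cat IH0 IH1.
- by rewrite map_cat flatten_cat IH0 IH1.
Qed.

Lemma indices_tokens n (P : protocol n) :
  indices (tokens P) = iota 0 (size (words n)).
Proof. by case: P => * /=; rewrite size_map. Qed.

(** The tree-recursive form of [traverse], suited to induction on the protocol. The default of
    [head] is never taken, as the root always has a token. *)
Fixpoint attributes A O (emit : A -> token -> O)
    (down : bool -> A -> token -> A) n (P : protocol n) (a : A) : seq O :=
  let t := head (inl (false, [::])) (tokens P) in
  emit a t :: match P with
              | Output _ => [::]
              | Alice _ P0 P1 | Bob _ P0 P1 =>
                  attributes emit down P0 (down false a t) ++
                  attributes emit down P1 (down true a t)
              end.

Lemma traverse_tokens A O (emit : A -> token -> O)
    (down : bool -> A -> token -> A) n (P : protocol n) (a : A) :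
  traverse emit down a (tokens P) = attributes emit down P a.
Proof.
(* The tokens of a subtree consume exactly one pending attribute. *)
suff H l out : foldl (visit emit down) (a :: l, out) (tokens P) =
    (l, catrev (attributes emit down P a) out).
  by rewrite /traverse H catrevE cats0 revK.
elim: P a l out => [g|f P0 IH0 P1 IH1|f P0 IH0 P1 IH1] a l out //=.
- by rewrite foldl_cat [visit _ _ _ _]/= IH0 IH1 catrev_catl.
- by rewrite foldl_cat [visit _ _ _ _]/= IH0 IH1 catrev_catl.
Qed.

Lemma nth_words n T (d : T) (f : word n -> T) x :
  nth d [seq f w | w <- words n] (index x (words n)) = f x.
Proof. by rewrite (nth_map x) ?nth_index ?index_mem ?mem_words. Qed.

Lemma simulate_tokens n (P : protocol n) x y t o :
  run P x y = Some (t, o) ->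
  simulate (index x (words n)) (index y (words n)) (tokens P) = (rev t, o).
Proof.
set i := index x _; set j := index y _ => rP.
(* Subtrees off the path of the run emit nothing. *)
have inactive (Q : protocol n) :
    pmap id (attributes (sim_emit i) (sim_down i j) Q None) = [::].
  by elim: Q => [g|f P0 IH0 P1 IH1|f P0 IH0 P1 IH1] //=;
    rewrite pmap_cat IH0 IH1.
suff H s : pmap id (attributes (sim_emit i) (sim_down i j) P (Some s)) =
    [:: (catrev t s, o)] by rewrite /simulate traverse_tokens H.
elim: P s t rP => [g|f P0 IH0 P1 IH1|f P0 IH0 P1 IH1] s t /=.
- by rewrite nth_words; case: (g x) => //= v [<- <-].
- rewrite nth_words; case: (f x) => //= -[].
    case rP: (run P1 x y) => [[t' o']|] //= [<- oE].
    by rewrite pmap_cat inactive /= (IH1 _ t') // rP oE.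
  case rP: (run P0 x y) => [[t' o']|] //= [<- oE].
  by rewrite pmap_cat inactive /= cats0 (IH0 _ t') // rP oE.
- rewrite nth_words; case: (f y) => //= -[].
    case rP: (run P1 x y) => [[t' o']|] //= [<- oE].
    by rewrite pmap_cat inactive /= (IH1 _ t') // rP oE.
  case rP: (run P0 x y) => [[t' o']|] //= [<- oE].
  by rewrite pmap_cat inactive /= cats0 (IH0 _ t') // rP oE.
Qed.

(** * Shortest transcripts and the one-way protocol *)

Lemma words_uniq n : uniq (words n).
Proof.
elim: n => //= n IH; rewrite cats0.
rewrite cat_uniq !map_inj_uniq //; try by move=> v w /(congr1 val) [] /val_inj.
rewrite IH andbT; apply/hasPn => _ /mapP[w _ ->].
by apply/mapP => -[w' _ /(congr1 val)].
Qed.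

Definition best_run n (P : protocol n) (y : word n) : seq bool * seq bool :=
  let r := best (tokens P) (indices (tokens P)) (index y (words n)) in
  (rev r.1, r.2).

Lemma foldl_shorter (I : eqType) (f : I -> seq bool * seq bool) i0 s :
  exists2 i, (i \in i0 :: s) &
    foldl (fun r i => shorter r (f i)) (f i0) s = f i /\
    forall i', i' \in i0 :: s -> size (f i).1 <= size (f i').1.
Proof.
elim: s i0 => [|i1 s IH] i0 /=.
  by exists i0; rewrite ?inE //; split=> // i'; rewrite inE => /eqP->.
rewrite [shorter (f i0) _]/shorter; case: leqP => [le01|/ltnW le10].
- have [i is0 [-> min_i]] := IH i0; exists i.
    by move: is0; rewrite !inE => /orP[->|->]; rewrite ?orbT.
  split=> // i'; rewrite !inE orbCA => /orP[/eqP->|i's].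
    by apply: leq_trans le01; apply: min_i; rewrite inE eqxx.
  by apply: min_i; rewrite inE.
- have [i is1 [-> min_i]] := IH i1; exists i; first by rewrite inE is1 orbT.
  split=> // i'; rewrite inE => /orP[/eqP->|]; last exact: min_i.
  by apply: leq_trans le10; apply: min_i; rewrite inE eqxx.
Qed.

Lemma best_runP n (P : protocol n) (y : word n) : Defs.total P ->
  exists2 x, run P x y = Some (best_run P y) &
    forall x' r, run P x' y = Some r -> size (best_run P y).1 <= size r.1.
Proof.
move=> totP; pose sim i := simulate i (index y (words n)) (tokens P).
have simE x : run P x y =
    Some (rev (sim (index x (words n))).1, (sim (index x (words n))).2).
  by have [[t o] rP] := totP x y; rewrite /sim (simulate_tokens rP) revK.
(* The fold in [best] starts at index 0, which must be the index of a word. *)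
have words_gt0 : 0 < size (words n).
  by apply: leq_ltn_trans (etrans (index_mem y _) (mem_words y)).
rewrite /best_run /best indices_tokens.
have [i i_idx [-> min_i]] := foldl_shorter sim 0 (iota 0 (size (words n))).
have iN : i < size (words n).
  by move: i_idx; rewrite inE mem_iota => /orP[/eqP->|].
exists (nth y (words n) i); first by rewrite simE index_uniq ?words_uniq.
move=> x r; rewrite simE => -[<-]; rewrite !size_rev; apply: min_i.
by rewrite inE mem_iota /= add0n index_mem mem_words orbT.
Qed.

(* [T y] consists of what Bob has still to send on input y and of the word that
   Alice is to output; it is [None] if the run on y avoids the subtree. *)
Fixpoint bobify n (P : protocol n)
    (T : word n -> option (seq bool * seq bool)) : protocol n :=
  match P with
  | Output _ =>
      Output [ffun _ => Some (head ([::], [::]) (pmap T (words n))).2]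
  | Alice _ P0 P1 | Bob _ P0 P1 =>
      Bob [ffun y => if T y is Some q then ohead q.1 else None]
        (bobify P0 (fun y => advance false (T y)))
        (bobify P1 (fun y => advance true (T y)))
  end.

Lemma one_way_bobify n (P : protocol n) T : one_way (bobify P T).
Proof. by elim: P T => //= f P0 IH0 P1 IH1 T; rewrite IH0 IH1. Qed.

Lemma attributes_bobify n (P : protocol n) T :
  attributes bob_emit bob_down P [seq T w | w <- words n] =
  tokens (bobify P T).
Proof.
elim: P T => [g|f P0 IH0 P1 IH1|f P0 IH0 P1 IH1] T /=.
- congr [:: inl (_, _)]; rewrite -map_comp; apply: eq_map => w.
  rewrite ffunE /=; congr (Some (head _ _).2).
  by elim: (words n) => //= v s ->.
- rewrite /bob_down -!map_comp (IH0 (fun y => _)) (IH1 (fun y => _)).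
  by congr (inr (_, _) :: _); apply: eq_map => w; rewrite ffunE.
- rewrite /bob_down -!map_comp (IH0 (fun y => _)) (IH1 (fun y => _)).
  by congr (inr (_, _) :: _); apply: eq_map => w; rewrite ffunE.
Qed.

Lemma convert_tokens n (P : protocol n) :
  convert (tokens P) = tokens (bobify P (fun y => Some (best_run P y))).
Proof.
rewrite -attributes_bobify /convert traverse_tokens; congr attributes.
rewrite indices_tokens.
apply: (@eq_from_nth _ None); rewrite !size_map size_iota //.
move=> j jN; rewrite (nth_map 0) ?size_iota // nth_iota // add0n.
pose y0 : word n := [tuple of nseq n false].
by rewrite (nth_map y0) // /best_run indices_tokens index_uniq ?words_uniq.
Qed.

(** * Correctness of the one-way protocol *)

Fixpoint leaf_path n (P : protocol n) (t : seq bool) : bool :=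
  match P, t with
  | Output _, [::] => true
  | Alice _ P0 P1, b :: t | Bob _ P0 P1, b :: t =>
      leaf_path (if b then P1 else P0) t
  | _, _ => false
  end.

Lemma run_leaf_path n (P : protocol n) x y r :
  run P x y = Some r -> leaf_path P r.1.
Proof.
elim: P r => [g|f P0 IH0 P1 IH1|f P0 IH0 P1 IH1] r /=.
- by case: (g x) => //= v [<-].
- case: (f x) => //= -[]; [case: (run P1 x y) IH1|case: (run P0 x y) IH0];
    by move=> // r' IH [<-] /=; exact: IH.
- case: (f y) => //= -[]; [case: (run P1 x y) IH1|case: (run P0 x y) IH0];
    by move=> // r' IH [<-] /=; exact: IH.
Qed.

(** The invariant passed down the tree: each message ends exactly at a leaf, so Bob neither stops
    early nor has bits left over, and equal messages carry the same word. *)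
Definition decodable n (P : protocol n)
    (T : word n -> option (seq bool * seq bool)) : Prop :=
  (forall y q, T y = Some q -> leaf_path P q.1) /\
  (forall y y' q q', T y = Some q -> T y' = Some q' -> q.1 = q'.1 ->
     q.2 = q'.2).

Lemma decodable_advance n (P P' : protocol n) T b :
  (forall t, leaf_path P (b :: t) = leaf_path P' t) ->
  decodable P T -> decodable P' (fun y => advance b (T y)).
Proof.
have adv e q : advance b e = Some q -> e = Some (b :: q.1, q.2).
  by case: e => [[[|c s] w]|] //=; case: eqP => // -> [<-].
move=> PP' [leafT injT].
split=> [y q /adv/leafT|y y' q q' /adv Ty /adv Ty' qq'].
  by rewrite PP'.
by apply: (injT _ _ _ _ Ty Ty'); rewrite /= qq'.
Qed.

Lemma run_bobify n (P : protocol n) T x y q :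
  decodable P T -> T y = Some q -> run (bobify P T) x y = Some q.
Proof.
elim: P T q => [g|f P0 IH0 P1 IH1|f P0 IH0 P1 IH1] T q dT Ty /=.
- have [leafT injT] := dT; rewrite ffunE /=; set l := pmap T (words n).
  have : q \in l by rewrite mem_pmap -Ty; apply: map_f; exact: mem_words.
  (* The leaf outputs the word of the first entry of [l]. All messages that arrive here are empty,
     so by the second half of [decodable] this word is that of [q]. *)
  have : head ([::], [::]) l \in pmap T (words n) \/ l = [::].
    by rewrite -/l; case: l => [|q' l]; [right|left; rewrite mem_head].
  case=> [|-> //]; rewrite mem_pmap => /mapP[y' _ Ty'] _.
  move: (leafT _ _ Ty) (leafT _ _ (esym Ty')) (injT _ _ _ _ Ty (esym Ty')).
  case: q {Ty} => -[|//] w /= _; case: (head _ l) {Ty'} => -[|//] w' /= _.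
  by move=> ->.
- rewrite ffunE Ty; case: q Ty => -[|b t] w Ty /=; first by have := dT.1 _ _ Ty.
  by case: b Ty => Ty; [rewrite (IH1 _ (t, w))|rewrite (IH0 _ (t, w))];
    rewrite ?Ty //; exact: decodable_advance dT.
- rewrite ffunE Ty; case: q Ty => -[|b t] w Ty /=; first by have := dT.1 _ _ Ty.
  by case: b Ty => Ty; [rewrite (IH1 _ (t, w))|rewrite (IH0 _ (t, w))];
    rewrite ?Ty //; exact: decodable_advance dT.
Qed.

(** With equal transcripts, the bits at Alice's nodes are justified by [x] and those at Bob's by
    [y']. The output is [o] because the leaf applies its label to [x]. *)
Lemma run_rectangle n (P : protocol n) x x' y y' t o o' :
  run P x y = Some (t, o) -> run P x' y' = Some (t, o') ->
  run P x y' = Some (t, o).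
Proof.
elim: P t o o' => [//|f P0 IH0 P1 IH1|f P0 IH0 P1 IH1] t o o' /=.
- case: (f x) => //= b; case: (f x') => //= b'.
  case r: (if b then _ else _) => [[t1 o1]|] //= [<- <-].
  case r': (if b' then _ else _) => [[t1' o1']|] //= [bb' tt' _].
  move: r r'; rewrite {}bb' {}tt'.
  by case: b => r r'; [rewrite (IH1 _ _ _ r r')|rewrite (IH0 _ _ _ r r')].
- case: (f y) => //= b; case: (f y') => //= b'.
  case r: (if b then _ else _) => [[t1 o1]|] //= [<- <-].
  case r': (if b' then _ else _) => [[t1' o1']|] //= [bb' tt' _].
  move: r r'; rewrite {}bb' {}tt'.
  by case: b => r r'; [rewrite (IH1 _ _ _ r r')|rewrite (IH0 _ _ _ r r')].
Qed.

(** * Minima and the comparison of the two complexities *)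

Lemma min_natP S k : min_nat S = Some k -> S k.
Proof.
rewrite /min_nat; case: boolp.pselect => // H [<-].
by case: ex_minnP => m /boolp.asboolP.
Qed.

Lemma min_nat_le S k a : S k -> k <= a -> le_enat (min_nat S) (Some a).
Proof.
move=> Sk ka; rewrite /min_nat; case: boolp.pselect => [H|[]]; last first.
  by exists k; apply/boolp.asboolP.
case: ex_minnP => m _ /(_ k) min_m /=; apply: leq_trans ka; apply: min_m.
exact/boolp.asboolP.
Qed.

Lemma min_nat_bound S a : le_enat (min_nat S) (Some a) ->
  exists2 k, S k & k <= a.
Proof.
by case E: (min_nat S) => [k|] // ka; exists k => //; exact: min_natP.
Qed.

Lemma bobify_identity n (P : protocol n) x y :
  Defs.total P -> computes P (@identity n) ->
  run (bobify P (fun y => Some (best_run P y))) x y = Some (best_run P y).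
Proof.
move=> totP cP.
have bestE y' : (best_run P y').2 = y'.
  have [x' rx' _] := best_runP y' totP.
  by have := cP x' y'; rewrite rx' => -[].
apply: run_bobify => //; split=> [y' _ [<-]|y1 y2 _ _ [<-] [<-] eqt].
  by have [x' /run_leaf_path] := best_runP y' totP.
(* If [y1] and [y2] have equal messages, the run on [(x1, y2)] outputs the same as the run on
   [(x1, y1)]; as [P] computes the identity, this output is [y2]. *)
have [x1 r1 _] := best_runP y1 totP; have [x2 r2 _] := best_runP y2 totP.
rewrite (surjective_pairing (best_run P y1)) in r1.
rewrite (surjective_pairing (best_run P y2)) -eqt in r2.
have := cP x1 y2; rewrite (run_rectangle r1 r2) => -[y2E].
by rewrite [RHS]bestE.
Qed.

Theorem theorem4 (U : TM) (U_universal : universal U) :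
  exists C : nat, forall (n alpha : nat) (x y : word n),
    le_enat (TCC_one_way U (@identity n) (alpha + C) y)
            (TCC U (@identity n) alpha x y).
Proof.
have enc_token (t : token) : enc t <> [::] by case: t.
have [M eM] := exec_flatten enc_token computable_convert.
(* [C] is the cost of simulating one fixed machine, chosen before [n], [alpha] and the protocol. *)
have [C CU] := U_universal (postcompose U M).
exists C => n alpha x y.
case E: (TCC U _ _ _ _) => [k|]; last by case: (TCC_one_way _ _ _ _).
have [P [totP cP aP CCk]] := min_natP E.
pose P' := bobify P (fun y => Some (best_run P y)).
have runP' x' y' : run P' x' y' = Some (best_run P y').
  exact: bobify_identity.
apply: (min_nat_le (k := size (best_run P y).1)).
  exists P'; split.
  - exact: one_way_bobify.
  - by move=> x' y'; exists (best_run P y').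
  - move=> x' y'; rewrite runP' /=; have [x1 r1 _] := best_runP y' totP.
    by have := cP x1 y'; rewrite r1.
  (* A program [p] printing the code of [P] on [U] makes the composed machine print that of [P']
     under the same condition; simulating this on [U] adds at most [C] bits. *)
  - have [l [p pP <-] lea] := min_nat_bound aP.
    have pP' : prints (postcompose U M) p (str_of_nat n) (enc_protocol P').
      apply: prints_postcompose pP _; rewrite !enc_protocol_tokens.
      by rewrite -convert_tokens; exact: eM.
    have [q qP' leq] := CU _ _ _ pP'.
    apply: (min_nat_le (k := size q)); first by exists q.
    by apply: leq_trans leq _; rewrite leq_add2r.
  - by move=> x'; rewrite /CC runP'.
(* The run of [P] on [(x, y)] is one of those among which the message of [y] is shortest. *)
have [_ _ min_y] := best_runP y totP.
move: CCk; rewrite /CC; case r: (run P x y) => [r0|] //= [<-].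
exact: min_y r.
Qed.
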